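(* For any odd integer $d\ge 3$ and any integer $n\ge 0$, $$J_{d,n}:=\int_{[0,1]^d}\frac{\prod_{j=1}^d x_j^n(1-x_j)^n}{Q_d(x_1,\ldots,x_d)^{n+1}}\,dx_1\cdots dx_d\in\mathbb{Q}+\mathbb{Q}\,\zeta(3)+\mathbb{Q}\,\zeta(5)+\cdots+\mathbb{Q}\,\zeta(d).$$
   Context: $\zeta$ is the Riemann zeta function. The polynomials $Q_d$ are defined by $Q_1(x_1)=1-x_1$ and $Q_d(x_1,\ldots,x_d)=1-Q_{d-1}(x_1,\ldots,x_{d-1})\,x_d$ for $d\ge2$. The right-hand side denotes the $\mathbb{Q}$-vector space spanned by $1$ and the numbers $\zeta(k)$ with $k$ odd, $3\le k\le d$. *)

(* Defs.v *)
From HB Require Import structures.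
From mathcomp Require Import all_boot all_order all_algebra.
From mathcomp Require Import all_classical all_reals all_analysis.

Set Implicit Arguments.
Unset Strict Implicit.
Unset Printing Implicit Defensive.

Import Order.TTheory GRing.Theory Num.Theory.
Import numFieldNormedType.Exports.

Local Open Scope classical_set_scope.
Local Open Scope ring_scope.

Definition tuple_cons (T : Type) (d : nat) (p : T * d.-tuple T) :
  d.+1.-tuple T := [tuple of p.1 :: p.2].

(* Lebesgue measure on R^d, for the product sigma-algebra on tuples: the image
   of the product of Lebesgue measure on R and Lebesgue measure on R^(d-1)
   under (t, x) |-> t :: x; R^0 is a point of mass 1. *)
Fixpoint lebesgue_measure_tuple (R : realType) (d : nat) :
    set (d.-tuple (measurableTypeR R)) -> \bar R :=
  match d with
  | 0 => dirac [tuple]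
  | d'.+1 => pushforward
      (product_measure1 (@lebesgue_measure R) (@lebesgue_measure_tuple R d'))
      (@tuple_cons (measurableTypeR R) d')
  end.
Arguments lebesgue_measure_tuple R d : clear implicits.

Lemma measurable_tuple_cons d (T : measurableType d) n :
  measurable_fun setT (@tuple_cons T n).
Proof. exact: (@measurable_cons _ _ _ _ fst _ snd). Qed.

Section lebesgue_measure_tuple_step.
Context (R : realType) (d : nat).
Variable m : {sigma_finite_measure set (d.-tuple (measurableTypeR R)) -> \bar R}.

Let p : {measure
    set (measurableTypeR R * d.-tuple (measurableTypeR R))%type -> \bar R} :=
  (@lebesgue_measure R \x m)%E.

Definition lebesgue_measure_tuple_step :=
  pushforward p (@tuple_cons (measurableTypeR R) d).
Local Notation q := lebesgue_measure_tuple_step.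

Let mcons : measurable_fun setT (@tuple_cons (measurableTypeR R) d).
Proof. exact: measurable_tuple_cons. Qed.

Let q0 : q set0 = 0%E.
Proof. by rewrite /q /pushforward preimage_set0 measure0. Qed.

Let q_ge0 A : (0 <= q A)%E. Proof. exact: (measure_ge0 p). Qed.

Let q_sigma_additive : semi_sigma_additive q.
Proof. by apply: measure_semi_sigma_additive => //; exact: mcons. Qed.

HB.instance Definition _ := isMeasure.Build _ _ _ q q0 q_ge0 q_sigma_additive.

Let q_sigma_finite : sigma_finite setT q.
Proof.
have /sigma_finiteP[F [TF ndF Foo]] := sigma_finiteT (@lebesgue_measure R).
have /sigma_finiteP[G [TG ndG Goo]] := sigma_finiteT m.
pose g (x : d.+1.-tuple (measurableTypeR R)) := (thead x, [tuple of behead x]).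
have mg : measurable_fun setT g.
  by apply: measurable_fun_pair; [exact: measurable_tnth|exact: measurable_behead].
exists (fun n => g @^-1` (F n `*` G n)).
  apply/esym; rewrite -subTset => x _.
  have [i _ Fi] : (\bigcup_i F i) (g x).1 by rewrite -TF.
  have [j _ Gj] : (\bigcup_i G i) (g x).2 by rewrite -TG.
  exists (maxn i j) => //; split.
    by move: Fi; exact/subsetPset/ndF/leq_maxl.
  by move: Gj; exact/subsetPset/ndG/leq_maxr.
move=> n; have [mFn Fnoo] := Foo n; have [mGn Gnoo] := Goo n; split.
  by rewrite -[X in measurable X]setTI; apply: mg => //; exact: measurableX.
rewrite /q /pushforward -comp_preimage (_ : g \o _ = id) ?preimage_id.
  by rewrite /p /= product_measure1E// lte_mul_pinfty// ge0_fin_numE.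
by apply/funext => -[t x] /=; congr pair; exact/val_inj.
Qed.

HB.instance Definition _ := Measure_isSigmaFinite.Build _ _ _ q q_sigma_finite.

End lebesgue_measure_tuple_step.

Section lebesgue_measure_tuple_measure.
Context (R : realType).

Let bundled d :
  {m : {sigma_finite_measure set (d.-tuple (measurableTypeR R)) -> \bar R} |
   m = lebesgue_measure_tuple R d :> (set _ -> \bar R)}.
Proof.
elim: d => [|d [m mE]]; first by exists (dirac [tuple]).
by exists (lebesgue_measure_tuple_step m); rewrite /= -mE.
Qed.

Context (d : nat).
Local Notation mu := (lebesgue_measure_tuple R d).

Let mu0 : mu set0 = 0%E.
Proof. by have [m <-] := bundled d; exact: measure0. Qed.

Let mu_ge0 A : (0 <= mu A)%E.
Proof. by have [m <-] := bundled d; exact: measure_ge0. Qed.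

Let mu_sigma_additive : semi_sigma_additive mu.
Proof. by have [m <-] := bundled d; exact: measure_semi_sigma_additive. Qed.

HB.instance Definition _ := isMeasure.Build _ _ _ mu
  mu0 mu_ge0 mu_sigma_additive.

Let mu_sigma_finite : sigma_finite setT mu.
Proof. by have [m <-] := bundled d; exact: sigma_finiteT. Qed.

HB.instance Definition _ := Measure_isSigmaFinite.Build _ _ _ mu
  mu_sigma_finite.

End lebesgue_measure_tuple_measure.

Lemma measurable_box d (T : measurableType d) n (A : 'I_n -> set T) :
  (forall i, measurable (A i)) ->
  measurable [set x : n.-tuple T | forall i, A i (tnth x i)].
Proof.
move=> mA.
rewrite (_ : [set _ | _] =
    \bigcap_(i in [set: 'I_n]) ((@tnth n T ^~ i) @^-1` A i)).
  apply: fin_bigcap_measurable => // i _.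
  by rewrite -[X in measurable X]setTI; exact: measurable_tnth.
by apply/seteqP; split => x /= Ax i => [_|]; exact: Ax.
Qed.

Lemma lebesgue_measure_tuple_box (R : realType) d
    (A : 'I_d -> set (measurableTypeR R)) :
  (forall i, measurable (A i)) ->
  lebesgue_measure_tuple R d [set x | forall i, A i (tnth x i)] =
  (\prod_(i < d) lebesgue_measure (A i))%E.
Proof.
elim: d A => [|d IHd] A mA.
  by rewrite big_ord0 /= diracE mem_set// => -[].
rewrite big_ord_recl /= -IHd// /pushforward.
rewrite -product_measure1E; last 2 first.
- exact: mA.
- exact: (@measurable_box _ (measurableTypeR R) d (fun i => A (lift ord0 i))).
congr (_ _); apply/seteqP; split => -[t x] /=.
  move=> Ax; split=> [|i]; first exact: (Ax ord0).
  by have := Ax (lift ord0 i); rewrite tnthS /=; congr (A _ (tnth _ _)); exact/val_inj.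
move=> [At Ax] i; case: (unliftP ord0 i) => [j|] ->; last exact: At.
by have := Ax j; rewrite tnthS /=; congr (A _ (tnth _ _)); exact/val_inj.
Qed.

(* The Dirichlet series; its limit is zeta(s) for s > 1 only. *)
Definition riemann_zeta (R : realType) (s : R) : R :=
  limn (series (fun m : nat => m.+1%:R `^ (- s))).

(* Q d x is Q_d(x_1, ..., x_d), x_j being the entry of index j - 1 of x; with
   Q_0 = 1 the recursion also yields Q_1(x_1) = 1 - x_1. *)
Fixpoint Q (R : realType) (d : nat) (x : seq R) : R :=
  if d is d'.+1 then 1 - Q d' x * x`_d' else 1.

Definition unit_cube (R : realType) (d : nat) :
  set (d.-tuple (measurableTypeR R)) :=
  [set x | forall j, (tnth x j : R) \in `[0, 1]].
Arguments unit_cube R d : clear implicits.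

(* On the null set where Q_d vanishes the integrand is 0, since 0^-1 = 0. *)
Definition J (R : realType) (d n : nat) : \bar R :=
  (\int[lebesgue_measure_tuple R d]_(x in unit_cube R d)
    ((\prod_(j < d) ((tnth x j : R) ^+ n * (1 - (tnth x j : R)) ^+ n)) /
       Q d (x : seq R) ^+ n.+1)%:E)%E.

Definition odd_zeta_span (R : realType) (d : nat) : set R :=
  [set r | exists (q0 : rat) (q : nat -> rat),
     r = ratr q0 +
         \sum_(3 <= k < d.+1 | odd k) ratr (q k) * riemann_zeta (k%:R : R)].
Arguments odd_zeta_span R d : clear implicits.

(* Main.v *)
Require Import Defs.
From HB Require Import structures.
From mathcomp Require Import all_boot all_order all_algebra.
From mathcomp Require Import all_classical all_reals all_analysis.
From mathcomp Require Import measurable_realfun.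
From mathcomp Require Import ring lra zify.

Set Implicit Arguments.
Unset Strict Implicit.
Unset Printing Implicit Defensive.

Import Order.TTheory GRing.Theory Num.Theory.
Import numFieldNormedType.Exports.

Local Open Scope classical_set_scope.
Local Open Scope ring_scope.

(** Let [T] be the operator [(T f)(q) = \int_0^1 t^n (1 - t)^n f(1 - q t) dt].
    Since [Q_{d+1}(t, x)] is [Q_d(x)] computed with the initial value [1 - t]
    in place of [1], integrating over the first coordinate last shows that the
    integral [J_d] is [(T^d f)(1)] with [f(q) = q^{-(n+1)}]
    ([integral_integrand], [J_iter_transform]).

    In the variable [u = 1 - q], [T] maps [u^k] to [b_k q^k], where [b_k] is
    the Beta integral [(n+k)! n! / (2n+k+1)!].  So [T] preserves the degree
    filtration of polynomials, with the eigenvalues [(-1)^m b_m]; its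
    eigenvectors are the Jacobi polynomials orthogonal for the weight
    [q^{2n+1} (1-q)^n].  They enter only through
    the value at [q = 1] of the projection of [u^k] to the [m]-th eigenline.
    Its closed form satisfies two finite binomial identities
    ([projection_eigen], [projection_sum]), and these yield [(T^d u^k)(1)] as a
    sum over [m <= k] ([iter_poly_transform1]).

    The expansion [q^{-(n+1)} = \sum_k C(n+k, k) u^k] has nonnegative
    coefficients, so monotone convergence writes [J_d] as a double series over
    [k] and [m] ([iter_transform_series]).  For odd [d] all its terms are
    nonnegative, because the sign of the projection and that of the eigenvalue
    to the power [d] cancel.  Exchanging the sums and summing over [k] with the
    Gauss formula ([gauss_sum]) leaves a constant times [\sum_m r(m)] for the
    very-well-poised rational function ([J_well_poised])
      [r(t) = (2t+3n+2) \prod_{l=1}^n (t+l) \prod_{l=1}^n (t+2n+1+l)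
              / \prod_{i=0}^n (t+n+1+i)^{d+1}].

    Its degree is at most -2, so its residues add up to zero; and for odd [d]
    it is odd under [t -> -(3n+2) - t], a reflection that permutes the poles,
    so the coefficients of its partial fraction expansion add up to zero in
    each even order ([well_poised_partial_fractions]).  Only the zeta values at
    the odd integers from 3 to [d] survive the summation
    ([well_poised_series]). *)

(** * The integral operator on polynomials *)

Section Moments.
Variable R : numFieldType.
Implicit Types (n k m r a c d j : nat).

Lemma factr_neq0 n : n`!%:R != 0 :> R.
Proof. by rewrite pnatr_eq0 -lt0n fact_gt0. Qed.

Lemma factrS n : (n.+1)`!%:R = (n%:R + 1) * n`!%:R :> R.
Proof. by rewrite factS natrM -natr1. Qed.

Lemma natr1_neq0 n : n%:R + 1 != 0 :> R.
Proof. by rewrite natr1 pnatr_eq0. Qed.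

(** Pascal's rule: an alternating binomial sum is an iterated finite
    difference. *)
Lemma alternating_binomial_sumS (f : nat -> R) r :
  \sum_(i < r.+2) (-1) ^+ i * 'C(r.+1, i)%:R * f i =
  \sum_(i < r.+1) (-1) ^+ i * 'C(r, i)%:R * f i -
  \sum_(i < r.+1) (-1) ^+ i * 'C(r, i)%:R * f i.+1.
Proof.
rewrite big_ord_recl /= bin0.
under eq_bigr => i _ do rewrite /bump /= add1n binS natrD mulrDr mulrDl.
rewrite big_split /= addrA -sumrN; congr (_ + _).
  rewrite [RHS]big_ord_recl /= bin0 big_ord_recr /= bin_small // mulr0 mul0r addr0.
  by congr (_ + _); apply: eq_bigr => i _; rewrite /bump /= add1n.
by apply: eq_bigr => i _; rewrite exprS !mulN1r !mulNr.
Qed.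

(** The summand is, up to the constant [c!], the Beta integral of
    [x^(a+i) (1-x)^c], so the sum is the Beta integral of
    [x^a (1-x)^(c+r)]. *)
Lemma alternating_beta_sum r a c :
  \sum_(i < r.+1) (-1) ^+ i * 'C(r, i)%:R * ((a + i)`!%:R / (a + i + c).+1`!%:R) =
  a`!%:R * (c + r)`!%:R / ((a + c + r).+1`!%:R * c`!%:R) :> R.
Proof.
elim: r a => [|r IH] a.
  rewrite big_ord1 bin0 !addn0.
  by field; rewrite !factr_neq0.
rewrite (alternating_binomial_sumS (fun i => (a + i)`!%:R / (a + i + c).+1`!%:R)).
under [X in _ - X]eq_bigr => i _ do rewrite addnS -addSn.
rewrite !IH !addSn !addnS !factrS -!natr1 !natrD.
have H1 := natr1_neq0 (a + c + r); have H2 := natr1_neq0 (a + c + r).+1.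
rewrite -!natr1 !natrD in H1 H2.
by field; rewrite ?factr_neq0 ?H1 ?H2.
Qed.

Lemma binrE a b : 'C(a + b, a)%:R = (a + b)`!%:R / (a`!%:R * b`!%:R) :> R.
Proof.
rewrite -(bin_fact (leq_addr b a)) addKn !natrM.
by rewrite mulfK ?mulf_neq0 ?factr_neq0.
Qed.

(** Trinomial revision [C(k, m+i) C(m+i, m) = C(k, m) C(k-m, i)]. *)
Lemma alternating_binomial_restrict (f : nat -> R) k m : (m <= k)%N ->
  \sum_(j < k.+1) (-1) ^+ j * 'C(k, j)%:R * ('C(j, m)%:R * f j) =
  (-1) ^+ m * 'C(k, m)%:R *
  \sum_(i < (k - m).+1) (-1) ^+ i * 'C(k - m, i)%:R * f (m + i)%N.
Proof.
move=> mk.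
rewrite -(big_mkord xpredT (fun j => (-1) ^+ j * 'C(k, j)%:R * ('C(j, m)%:R * f j))).
rewrite (big_cat_nat (n := m)) //=; last exact: leq_trans mk (leqnSn _).
rewrite big_nat_cond big1 ?add0r; last first.
  by move=> j /andP[/andP[_ jm] _]; rewrite (bin_small jm) mul0r mulr0.
rewrite -{1}[m]add0n big_addn subSn // big_mkord mulr_sumr.
apply: eq_bigr => i _; have ik : (i <= k - m)%N by rewrite -ltnS.
move: (i : nat) ik => {}i ik.
have -> : k = (m + (i + (k - m - i)))%N by rewrite subnKC // subnKC.
rewrite addKn [(i + m)%N]addnC; set l := (k - m - i)%N.
rewrite exprD [X in 'C(X, m + i)]addnA !binrE -addnA.
by field; rewrite !factr_neq0.
Qed.

(** The Beta integral of [x^(n+k) (1-x)^n]. *)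
Definition beta_moment n k : R := (n + k)`!%:R * n`!%:R / (n + k + n).+1`!%:R.
Definition eigenvalue n m : R := (-1) ^+ m * beta_moment n m.

(** The value at 1 of the projection of [(1-X)^k] to the [m]-th eigenline of
    the operator [T]; [n * 3 + 2] is the sum of the exponents [n] and [2n+1] of
    the Jacobi weight, plus 1. *)
Definition projection n k m : R :=
  (-1) ^+ m * 'C(k, m)%:R *
  ((m.*2 + (n * 3 + 2))%:R * (m + (n * 3).+1)`!%:R / (m + k + (n * 3 + 2))`!%:R) *
  ((n + k)`!%:R / n`!%:R).

(** With [T (1-X)^k = b_k X^k = b_k \sum_j (-1)^j C(k, j) (1-X)^j], this says
    that the linear form sending each [(1-X)^k] to its [m]-th projection at 1
    is an eigenvector of the transpose of [T]. *)
Lemma projection_eigen n k m :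
  beta_moment n k * \sum_(j < k.+1) (-1) ^+ j * 'C(k, j)%:R * projection n j m =
  eigenvalue n m * projection n k m.
Proof.
have [mk|km] := leqP m k; last first.
  rewrite [in RHS]/projection (bin_small km) mulr0 !mul0r mulr0 big1 ?mulr0 // => j _.
  rewrite /projection (@bin_small j) ?mulr0 ?mul0r ?mulr0 //.
  by rewrite (leq_trans _ km).
pose c := ((n * 2).+1 + m)%N.
pose C : R := (-1) ^+ m * (m.*2 + (n * 3 + 2))%:R * (m + (n * 3).+1)`!%:R / n`!%:R.
pose f j : R := C * ((n + j)`!%:R / (n + j + c).+1`!%:R).
have E j : projection n j m = 'C(j, m)%:R * f j.
  rewrite /projection /f /C; have -> : (m + j + (n * 3 + 2) = (n + j + c).+1)%N.
    by rewrite /c; lia.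
  by rewrite -!mulrA; ring.
under eq_bigr => j _ do rewrite E.
rewrite alternating_binomial_restrict // E /f.
under eq_bigr => i _ do rewrite mulrCA addnA.
rewrite -mulr_sumr alternating_beta_sum /eigenvalue /beta_moment.
have -> : (c + (k - m) = n + k + n + 1)%N by rewrite /c; lia.
have -> : (n + m + c + (k - m) = n + k + c)%N by rewrite /c; lia.
have -> : (c = n + m + n + 1)%N by rewrite /c; lia.
rewrite !addn1 /C; set S1 := (-1) ^+ m.
by field; rewrite !factr_neq0.
Qed.

(** The projections of [(1-X)^k] add up to [(1-X)^k], whose value at 1 is 0
    unless [k = 0].  The sum telescopes. *)
Lemma projection_sum n k : \sum_(m < k.+1) projection n k m = (k == 0%N)%:R.
Proof.
case: k => [|k].
  rewrite big_ord1 /projection bin0 expr0 !add0n !addn0 !mul1r.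
  rewrite !addnS addn0 !factrS -!natr1.
  have h1 := natr1_neq0 (n * 3); have h2 := natr1_neq0 (n * 3).+1.
  rewrite -?natr1 !natrM in h1 h2.
  by field; rewrite !factr_neq0 h1 h2.
rewrite eqn0Ngt /=.
pose A := (n * 3 + 1)%N.
pose G m : R := if m is m'.+1 then
   (-1) ^+ m' * 'C(k, m')%:R * (m + A)`!%:R / (m + k + A).+1`!%:R else 0.
pose K : R := (n + k.+1)`!%:R / n`!%:R.
have E m : projection n k.+1 m = K * (G m.+1 - G m).
  rewrite /projection -/K mulrC; congr (_ * _).
  have -> : (m + k.+1 + (n * 3 + 2) = (m + k + A).+2)%N by rewrite /A; lia.
  have -> : (m.*2 + (n * 3 + 2) = m + m + A + 1)%N by rewrite /A; lia.
  have -> : (m + (n * 3).+1 = m + A)%N by rewrite /A; lia.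
  rewrite /G; clear; clearbody A; case: m => [|m] /=.
    by rewrite !bin0 !expr0 !add1n !addSn !add0n !addn1 (factrS A) -natr1; ring.
  (* C(k, m) (k - m) = C(k, m+1) (m + 1), free of the truncated subtraction *)
  have H : 'C(k, m)%:R * k%:R = 'C(k, m)%:R * m%:R + 'C(k, m.+1)%:R * (m%:R + 1) :> R.
    have [mk|km] := leqP m k; last by rewrite !bin_small ?mul0r ?add0r // leqW.
    rewrite -{2}(subnK mk) natrD mulrDr addrC; congr (_ + _).
    by rewrite natr1 -!natrM [in RHS]mulnC mul_bin_left mulnC.
  have -> : 'C(k.+1, m.+1)%:R = 'C(k, m.+1)%:R + 'C(k, m)%:R :> R by rewrite binS natrD.
  have -> : 'C(k, m.+1)%:R = 'C(k, m)%:R * (k%:R - m%:R) / (m%:R + 1) :> R.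
    apply: (mulIf (natr1_neq0 m)).
    by rewrite divfK ?natr1_neq0 // mulrBr H [RHS]addrC addKr.
  rewrite !addSn !factrS exprS !natrD -!natr1 !natrD.
  have h0 := natr1_neq0 m; have h1 := natr1_neq0 (m + k + A).
  have h2 := natr1_neq0 (m + k + A).+1; have h3 := natr1_neq0 (m + k + A).+2.
  rewrite -!natr1 !natrD in h1 h2 h3.
  by field; rewrite !factr_neq0 h0 h1 h2 h3.
under eq_bigr => m _ do rewrite E.
rewrite -mulr_sumr -(big_mkord xpredT (fun m => G m.+1 - G m)) telescope_sumr //.
by rewrite /G bin_small // mulr0 !mul0r subrr mulr0.
Qed.


(** For [p(x) = \sum_j p_j x^j], the polynomial in [q] with value
    [\int_0^1 t^n (1-t)^n p(q t) dt]. *)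
Definition beta_mult n (p : {poly R}) : {poly R} :=
  \poly_(j < size p) (p`_j * beta_moment n j).

Lemma coef_beta_mult n p j : (beta_mult n p)`_j = p`_j * beta_moment n j.
Proof.
by rewrite coef_poly; case: ltnP => // pj; rewrite nth_default // mul0r.
Qed.

Fact beta_mult_is_linear n : linear (beta_mult n).
Proof.
move=> a p q; apply/polyP => j.
by rewrite !(coefD, coefZ, coef_beta_mult) mulrDl mulrA.
Qed.
HB.instance Definition _ n :=
  GRing.isLinear.Build R {poly R} {poly R} _ (beta_mult n) (beta_mult_is_linear n).

Definition poly_transform n (p : {poly R}) : {poly R} := beta_mult n (p \Po (1 - 'X)).

Fact poly_transform_is_linear n : linear (poly_transform n).
Proof. by move=> a p q; rewrite /poly_transform linearP linearP. Qed.
HB.instance Definition _ n :=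
  GRing.isLinear.Build R {poly R} {poly R} _ (poly_transform n)
    (poly_transform_is_linear n).

Fact iter_poly_transform_is_linear n d : linear (iter d (poly_transform n)).
Proof. by elim: d => // d IH a p q; rewrite !iterS IH linearP. Qed.
HB.instance Definition _ n d :=
  GRing.isLinear.Build R {poly R} {poly R} _ (iter d (poly_transform n))
    (iter_poly_transform_is_linear n d).

Lemma poly_transform_exp n k :
  poly_transform n ((1 - 'X) ^+ k) =
  \sum_(j < k.+1) (beta_moment n k * ((-1) ^+ j * 'C(k, j)%:R)) *: (1 - 'X) ^+ j.
Proof.
have -> : poly_transform n ((1 - 'X) ^+ k) = beta_moment n k *: 'X^k.
  rewrite /poly_transform rmorphXn /= rmorphB /= comp_polyX comp_polyC subKr.
  apply/polyP => j; rewrite coef_beta_mult coefZ coefXn mulrC.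
  by case: eqP => [->|]; rewrite ?mulr0.
rewrite -{1}(subKr 1 'X) exprBn scaler_sumr; apply: eq_bigr => j _.
rewrite expr1n mulr1 -scalerA; congr (_ *: _).
rewrite -mul_polyC polyCM polyC_exp polyCN polyC1 polyC_natr -mulr_natr; ring.
Qed.

(** Spectral expansion of the iterates of [T], obtained by transposition. *)
Lemma iter_poly_transform1 n d k :
  (iter d (poly_transform n) ((1 - 'X) ^+ k)).[1] =
  \sum_(m < k.+1) projection n k m * eigenvalue n m ^+ d.
Proof.
elim: d k => [|d IH] k.
  rewrite /= horner_exp !hornerE subrr expr0n.
  by under eq_bigr => m _ do rewrite expr0 mulr1; rewrite projection_sum.
rewrite iterSr poly_transform_exp linear_sum horner_sum /=.
under eq_bigr => j _.
  rewrite linearZ hornerZ IH.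
  rewrite (big_ord_widen_cond k.+1 xpredT
    (fun m => projection n j m * eigenvalue n m ^+ d)) //=.
  rewrite big_mkcond /= mulr_sumr.
  over.
rewrite exchange_big /=; apply: eq_bigr => m _.
rewrite exprS mulrA [projection _ _ _ * _]mulrC -projection_eigen mulr_sumr mulr_suml.
apply: eq_bigr => j _; case: ltnP => jm; first by rewrite !mulrA.
by rewrite /projection (bin_small jm) !(mulr0, mul0r).
Qed.

End Moments.

(** * Partial fractions *)

Section PartialFractions.
Variables (F : fieldType) (N : nat) (c : 'I_N -> F).
Implicit Types (e : 'I_N -> nat) (f g : F -> F) (i : 'I_N) (s : seq 'I_N).

Definition off_poles (x : F) := forall i, x + c i != 0.

(** The span of the functions [1/(x + c i)^j] with [1 < j <= e i] and of the
    differences of two functions [1/(x + c i)] with [0 < e i].  Simple fractions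
    enter through differences only, which makes the residues add up to zero by
    construction.  Functions are compared away from all the poles. *)
Inductive pfrac e : (F -> F) -> Prop :=
| Pfrac_eq f g of pfrac e f & (forall x, off_poles x -> f x = g x) : pfrac e g
| Pfrac0 : pfrac e (fun=> 0)
| Pfrac_add f g of pfrac e f & pfrac e g : pfrac e (fun x => f x + g x)
| Pfrac_scale k f of pfrac e f : pfrac e (fun x => k * f x)
| Pfrac_pow i j of (1 < j <= e i)%N : pfrac e (fun x => ((x + c i) ^+ j)^-1)
| Pfrac_diff i i' of (0 < e i)%N & (0 < e i')%N :
    pfrac e (fun x => (x + c i)^-1 - (x + c i')^-1).

Lemma pfrac_le e e' f : (forall i, e i <= e' i)%N -> pfrac e f -> pfrac e' f.
Proof.
move=> ee'; elim=> [{}f g _ IH fg||{}f g _ IHf _ IHg|k {}f _ IH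
  |i j /andP[j1 je]|i i' ei ei'].
- exact: Pfrac_eq IH fg.
- exact: Pfrac0.
- exact: Pfrac_add.
- exact: Pfrac_scale.
- by apply: Pfrac_pow; rewrite j1 (leq_trans je).
- by apply: Pfrac_diff; [exact: leq_trans (ee' i)|exact: leq_trans (ee' i')].
Qed.

Definition incr_order e i := fun i' => (e i' + (i' == i))%N.

Hypothesis c_inj : injective c.

(** For distinct nodes, [1/((x+c')(x+c))] is a multiple of the difference of
    [1/(x+c')] and [1/(x+c)]; this lowers the order at [c'] step by step. *)
Lemma pfrac_pow_div e i i' j : (0 < j <= e i')%N ->
  pfrac (incr_order e i) (fun x => ((x + c i') ^+ j)^-1 / (x + c i)).
Proof.
case: j => // j /= je.
have [<-|ii'] := eqVneq i' i.
  apply: (@Pfrac_eq _ (fun x => ((x + c i') ^+ j.+2)^-1)).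
    by apply: Pfrac_pow; rewrite /incr_order eqxx addn1.
  by move=> x _; rewrite -invfM -exprSr.
have cc : c i - c i' != 0 by rewrite subr_eq0 (inj_eq c_inj) eq_sym.
elim: j je => [|j IH] je.
  apply: (@Pfrac_eq _ (fun x => (c i - c i')^-1 * ((x + c i')^-1 - (x + c i)^-1))).
    apply: Pfrac_scale; apply: Pfrac_diff; rewrite /incr_order ?eqxx ?addn1 //.
    by rewrite ltn_addr.
  move=> x hx; have := hx i; have := hx i' => h' h.
  by rewrite expr1; field; rewrite cc h h'.
apply: (@Pfrac_eq _ (fun x => (c i - c i')^-1 * (((x + c i') ^+ j.+2)^-1 +
   (-1) * (((x + c i') ^+ j.+1)^-1 / (x + c i))))).
  apply: Pfrac_scale; apply: Pfrac_add; last exact/Pfrac_scale/IH/ltnW.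
  by apply: Pfrac_pow; rewrite /incr_order ltn_addr.
move=> x hx; have := hx i; have := hx i' => h' h.
rewrite !exprS; set y := (x + c i') ^+ j.
have y0 : y != 0 by rewrite expf_neq0.
by field; rewrite cc h h' y0.
Qed.

Lemma pfrac_div e i f : pfrac e f -> pfrac (incr_order e i) (fun x => f x / (x + c i)).
Proof.
elim=> [{}f g _ IH fg||{}f g _ IHf _ IHg|k {}f _ IH|i' j /andP[j1 je]|i1 i2 e1 e2].
- by apply: Pfrac_eq IH _ => x hx; rewrite fg.
- by apply: Pfrac_eq (Pfrac0 _) _ => x; rewrite mul0r.
- by apply: Pfrac_eq (Pfrac_add IHf IHg) _ => x; rewrite mulrDl.
- by apply: Pfrac_eq (Pfrac_scale k IH) _ => x; rewrite mulrA.
- by apply: pfrac_pow_div; rewrite (ltnW j1).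
- have h1 := @pfrac_pow_div e i i1 1 e1; have h2 := @pfrac_pow_div e i i2 1 e2.
  apply: Pfrac_eq (Pfrac_add h1 (Pfrac_scale (-1) h2)) _ => x _.
  by rewrite !expr1 mulN1r -mulNr -mulrDl.
Qed.

Definition multiplicity s := fun i => count_mem i s.

Lemma multiplicity_cons i s i' :
  multiplicity (i :: s) i' = incr_order (multiplicity s) i i'.
Proof. by rewrite /multiplicity /incr_order /= addnC eq_sym. Qed.

Lemma pfrac_multiplicity_cons i s f :
  pfrac (incr_order (multiplicity s) i) f -> pfrac (multiplicity (i :: s)) f.
Proof. by apply: pfrac_le => i'; rewrite multiplicity_cons. Qed.

Lemma pfrac_inv_prod s : (1 < size s)%N ->
  pfrac (multiplicity s) (fun x => (\prod_(i <- s) (x + c i))^-1).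
Proof.
elim: s => // i [//|i' s] IH _.
have [-> | s0] := eqVneq s [::].
  apply: pfrac_multiplicity_cons.
  have := @pfrac_pow_div (multiplicity [:: i']) i i' 1; rewrite /multiplicity /= eqxx.
  move=> /(_ isT).
  move=> /Pfrac_eq; apply => x _.
  by rewrite !big_cons big_nil mulr1 expr1 invfM mulrC.
apply: pfrac_multiplicity_cons; have := pfrac_div i (IH _).
rewrite /= ltnS lt0n size_eq0 s0 => /(_ isT) /Pfrac_eq; apply => x _.
by rewrite [in RHS]big_cons invfM mulrC.
Qed.

(** Dividing [p] by one factor [x + c i] leaves a fraction with fewer factors
    and a constant over the whole product, so only constant numerators need
    the multiplication by simple fractions. *)
Lemma pfrac_ratio s (p : {poly F}) : (size p < size s)%N ->
  pfrac (multiplicity s) (fun x => p.[x] / \prod_(i <- s) (x + c i)).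
Proof.
elim: s p => // i s IH p ps.
have [p0|p_neq0] := eqVneq p 0.
  by apply: Pfrac_eq (Pfrac0 _) _ => x _; rewrite p0 horner0 mul0r.
have /factor_theorem[q pE] : root (p - p.[- c i]%:P) (- c i).
  by rewrite rootE !hornerE subrr.
have {}pE : p = q * ('X - (- c i)%:P) + p.[- c i]%:P by rewrite -pE subrK.
have s1 : (1 < size (i :: s))%N.
  by apply: leq_ltn_trans ps; rewrite lt0n size_poly_eq0.
have hq : pfrac (multiplicity (i :: s)) (fun x => q.[x] / \prod_(i <- s) (x + c i)).
  have [q0|q_neq0] := eqVneq q 0.
    by apply: Pfrac_eq (Pfrac0 _) _ => x _; rewrite q0 horner0 mul0r.
  apply: (@pfrac_le (multiplicity s)).
    by move=> i'; rewrite multiplicity_cons leq_addr.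
  apply: IH; move: ps; rewrite pE size_polyDl size_Mmonic ?monicXsubC //
    size_XsubC addn2 ?ltnS //.
  by rewrite (leq_trans (size_polyC_leq1 _)) // lt0n size_poly_eq0.
apply: Pfrac_eq (Pfrac_add hq (Pfrac_scale p.[- c i] (pfrac_inv_prod s1))) _ => x hx.
rewrite {2}pE big_cons !hornerE opprK; have := hx i => hi.
have hs : \prod_(j <- s) (x + c j) != 0.
  by rewrite prodf_seq_neq0; apply/allP => j _; exact: hx.
by field; rewrite hs hi.
Qed.

Lemma pfrac_coefs D f : pfrac (fun=> D) f ->
  exists2 a : nat -> 'I_N -> F, \sum_i a 1 i = 0 &
    forall x, off_poles x ->
      f x = \sum_(1 <= j < D.+1) \sum_i a j i / (x + c i) ^+ j.
Proof.
elim=> [{}f g _ [a a1 af] fg||{}f g _ [a a1 af] _ [b b1 bg]|k {}f _ [a a1 af]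
  |i j /andP[j1 je]|i i' e1 _].
- by exists a => // x hx; rewrite -fg // af.
- exists (fun _ _ => 0); rewrite ?big1 // => x _.
  by rewrite big1 // => j _; rewrite big1 // => i _; rewrite mul0r.
- exists (fun j i => a j i + b j i); first by rewrite big_split /= a1 b1 addr0.
  move=> x hx; rewrite af // bg // -big_split; apply: eq_bigr => j _.
  by rewrite -big_split; apply: eq_bigr => i _; rewrite mulrDl.
- exists (fun j i => k * a j i); first by rewrite -mulr_sumr a1 mulr0.
  move=> x hx; rewrite af // mulr_sumr; apply: eq_bigr => j _.
  by rewrite mulr_sumr; apply: eq_bigr => i _; rewrite mulrA.
- exists (fun j' i' => ((j' == j) && (i' == i))%:R).
    by rewrite big1 // => i' _; rewrite (ltn_eqF j1).
  move=> x _; rewrite (bigD1_seq j) /= ?iota_uniq ?mem_index_iota ?ltnS ?(ltnW j1) //.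
  rewrite (bigD1 i) //= !eqxx mul1r !big1 ?addr0 //.
    by move=> j' /negPf jj'; rewrite big1 // => i' _; rewrite jj' mul0r.
  by move=> i' /negPf ->; rewrite andbF mul0r.
- exists (fun j' i1 => (j' == 1)%N%:R * ((i1 == i)%:R - (i1 == i')%:R)).
    rewrite -mulr_sumr mul1r sumrB (bigD1 i) //= [X in _ - X](bigD1 i') //= !eqxx.
    by rewrite !big1 ?addr0 ?subrr // => k /negPf ->.
  move=> x _; rewrite big_ltn ?ltnS // [X in _ = _ + X]big1_seq ?addr0; last first.
    move=> j; rewrite mem_index_iota => /and3P[_ j1 _]; rewrite big1 // => k _.
    by rewrite (gtn_eqF j1) !mul0r.
  under eq_bigr => k _ do rewrite mul1r mulrBl expr1.
  rewrite sumrB (bigD1 i) //= [X in _ = _ - X](bigD1 i') //= !eqxx !mul1r.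
  by rewrite !big1 ?addr0 // => k /negPf ->; rewrite mul0r.
Qed.

End PartialFractions.

(** The expansion of an odd function is replaced by that of
    [(f(x) - f(-A-x))/2], whose coefficients at a node and at the reflected
    node differ by the sign [-(-1)^j]; hence they cancel for even [j].  For
    [j = 1] the sum of the coefficients was already zero. *)
Lemma pfrac_antisymmetric (F : numFieldType) N (c : 'I_N -> F) (A : F)
    (r : 'I_N -> 'I_N) D (f : F -> F) :
  involutive r -> (forall i, c (r i) = A - c i) ->
  (forall x, f (- A - x) = - f x) -> pfrac c (fun=> D) f ->
  exists2 a : nat -> 'I_N -> F,
    forall j, (j == 1%N) || ~~ odd j -> \sum_i a j i = 0 &
    forall x, off_poles c x ->
      f x = \sum_(1 <= j < D.+1) \sum_i a j i / (x + c i) ^+ j.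
Proof.
move=> rK cr fA /pfrac_coefs[a a1 af].
have reindex_r G : \sum_i G (r i) = \sum_i G i :> F.
  by rewrite [RHS](reindex_inj (inv_inj rK)).
exists (fun j i => (a j i - (-1) ^+ j * a j (r i)) / 2).
  move=> j jP; rewrite -mulr_suml sumrB -mulr_sumr (reindex_r (a j)).
  case/orP: jP => [/eqP->|/negPf oj]; first by rewrite a1 mulr0 subrr mul0r.
  by rewrite -signr_odd oj mul1r subrr mul0r.
move=> x hx.
have hAx : off_poles c (- A - x).
  move=> i; have -> : - A - x + c i = - (x + c (r i)) by rewrite cr; ring.
  by rewrite oppr_eq0.
have -> : f x = (f x - f (- A - x)) / 2 by rewrite fA opprK; field.
rewrite !af // -sumrB mulr_suml; apply: eq_bigr => j _.
rewrite -(reindex_r (fun i => a j i / (- A - x + c i) ^+ j)) -sumrB mulr_suml.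
apply: eq_bigr => i _.
have -> : - A - x + c (r i) = - (x + c i) by rewrite cr; ring.
rewrite (exprNn (x + c i)) -(signr_odd _ j); have := hx i => hi.
have hj : (x + c i) ^+ j != 0 by rewrite expf_neq0.
move: (a j i) (a j (r i)) ((x + c i) ^+ j) hj => b b' y y0.
by case: (odd j) => /=; rewrite ?expr1 ?expr0; field; rewrite y0.
Qed.

Section WellPoised.
Variable F : numFieldType.

(** The poles of the well-poised function are the opposites of these. *)
Definition node n (i : 'I_n.+1) : F := (n.+1 + i)%:R.

Definition well_poised_numerator n : {poly F} :=
  (2%:R *: 'X + (n * 3 + 2)%:R%:P) *
  (\prod_(l < n) ('X + (l.+1)%:R%:P) * \prod_(l < n) ('X + (n.*2.+2 + l)%:R%:P)).

Definition well_poised d n (x : F) : F :=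
  (well_poised_numerator n).[x] / (\prod_(i < n.+1) (x + node i)) ^+ d.+1.

Lemma horner_XDC (a x : F) : ('X + a%:P).[x] = x + a.
Proof. by rewrite hornerD hornerX hornerC. Qed.

Lemma node_inj n : injective (@node n).
Proof.
by move=> i j /eqP; rewrite /node eqr_nat eqn_add2l => /eqP/val_inj.
Qed.

Lemma node_rev n (i : 'I_n.+1) : node (rev_ord i) = (n * 3 + 2)%:R - node i.
Proof.
apply/eqP; rewrite eq_sym subr_eq -natrD eqr_nat /=; apply/eqP.
have := ltn_ord i; lia.
Qed.

Lemma prodrN_ord n (f : 'I_n -> F) :
  \prod_(i < n) (- f (rev_ord i)) = (-1) ^+ n * \prod_(i < n) f i.
Proof.
by rewrite prodrN card_ord [in RHS](reindex_inj rev_ord_inj).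
Qed.

(** The reflection exchanges the two linear products of the numerator and
    reverses the nodes; the number of factors that change sign is even, apart
    from [2x + 3n + 2], because [d + 1] is even. *)
Lemma well_poised_antisymmetric d n x : odd d ->
  well_poised d n (- (n * 3 + 2)%:R - x) = - well_poised d n x.
Proof.
move=> od; set A := (n * 3 + 2)%N; rewrite /well_poised.
have -> : \prod_(i < n.+1) (- A%:R - x + node i) =
    (-1) ^+ n.+1 * \prod_(i < n.+1) (x + node i).
  rewrite -prodrN_ord; apply: eq_bigr => i _; rewrite node_rev -/A; ring.
rewrite [_ ^+ d.+1]exprMn -exprM -signr_odd oddM /= od andbF mul1r.
rewrite -mulNr; congr (_ / _).
rewrite /well_poised_numerator !hornerM !horner_prod.
rewrite !(hornerD, hornerZ, hornerX, hornerC) -/A.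
have -> : \prod_(l < n) ('X + (l.+1)%:R%:P).[- A%:R - x] =
   (-1) ^+ n * \prod_(l < n) ('X + (n.*2.+2 + l)%:R%:P).[x].
  rewrite -prodrN_ord; apply: eq_bigr => l _; rewrite !horner_XDC.
  have -> : A%:R = (n.*2.+2 + rev_ord l)%:R + l.+1%:R :> F.
    by rewrite -natrD /A /=; congr _%:R; have := ltn_ord l; lia.
  ring.
have -> : \prod_(l < n) ('X + (n.*2.+2 + l)%:R%:P).[- A%:R - x] =
   (-1) ^+ n * \prod_(l < n) ('X + (l.+1)%:R%:P).[x].
  rewrite -prodrN_ord; apply: eq_bigr => l _; rewrite !horner_XDC.
  have -> : A%:R = (n.*2.+2 + l)%:R + (rev_ord l).+1%:R :> F.
    by rewrite -natrD /A /=; congr _%:R; have := ltn_ord l; lia.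
  ring.
have : (-1) ^+ n * (-1) ^+ n = 1 :> F by rewrite -expr2 sqrr_sign.
move: ((-1) ^+ n) (\prod_(l < n) _) (\prod_(l < n) _) => e u v ee.
transitivity (e * e * (- (2 * x + A%:R) * (u * v))); [ring | rewrite ee; ring].
Qed.

Lemma size_linear_prod n (b : 'I_n -> F) : size (\prod_(l < n) ('X + (b l)%:P)) = n.+1.
Proof.
under eq_bigr => l _ do rewrite -[b l]opprK polyCN.
by rewrite -big_enum size_prod_XsubC size_enum_ord.
Qed.

Lemma size_well_poised_numerator n : (size (well_poised_numerator n) <= n.*2.+2)%N.
Proof.
rewrite /well_poised_numerator (leq_trans (size_polyMleq _ _)) //.
have h1 : (size (2%:R *: 'X + (n * 3 + 2)%:R%:P : {poly F})%R <= 2)%N.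
  rewrite (leq_trans (size_polyD _ _)) // geq_max.
  rewrite (leq_trans (size_scale_leq _ _)) ?size_polyX //=.
  by rewrite (leq_trans (size_polyC_leq1 _)).
have h2 := size_polyMleq (\prod_(l < n) ('X + (l.+1)%:R%:P : {poly F}))
  (\prod_(l < n) ('X + (n.*2.+2 + l)%:R%:P : {poly F})).
rewrite !size_linear_prod in h2; move: h1 h2; set a := size _; set b := size _; lia.
Qed.

(** The numerator has degree at most [2n+1] and the denominator
    [(d+1)(n+1) >= 3(n+1)]. *)
Lemma pfrac_well_poised d n : (1 < d)%N ->
  pfrac (@node n) (fun=> d.+1) (well_poised d n).
Proof.
move=> d0; pose s k : seq 'I_n.+1 := flatten (nseq k (enum 'I_n.+1)).
have size_s k : size (s k) = (k * n.+1)%N.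
  by elim: k => //= k IH; rewrite size_cat size_enum_ord IH mulSn.
have mult_s k i : multiplicity (s k) i = k.
  elim: k => // k IH; rewrite /multiplicity /= count_cat -/(s k) [X in (_ + X)%N]IH.
    by rewrite count_uniq_mem ?enum_uniq // mem_enum.
have prod_s k x : \prod_(i <- s k) (x + node i) = (\prod_(i < n.+1) (x + node i)) ^+ k.
  elim: k => [|k IH]; first by rewrite big_nil.
  by rewrite exprS -IH big_cat /= big_enum.
have h : (size (well_poised_numerator n) < size (s d.+1))%N.
  by rewrite size_s (leq_ltn_trans (size_well_poised_numerator n)) //; nia.
have /pfrac_le := pfrac_ratio (@node_inj n) h.
move=> /(_ (fun=> d.+1) (fun i => eq_leq (mult_s _ _))) /Pfrac_eq.
by apply => x _; rewrite prod_s.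
Qed.

Lemma well_poised_partial_fractions d n : odd d -> (1 < d)%N ->
  exists2 a : nat -> 'I_n.+1 -> F,
    forall j, (j == 1%N) || ~~ odd j -> \sum_i a j i = 0 &
    forall t : nat,
      well_poised d n t%:R =
      \sum_(1 <= j < d.+2) \sum_i a j i / (t + n.+1 + i)%:R ^+ j.
Proof.
move=> od d0.
have [a a0 af] := pfrac_antisymmetric (@rev_ordK _) (@node_rev n)
  (fun x => well_poised_antisymmetric n x od) (pfrac_well_poised n d0).
exists a => // t; rewrite af => [|i]; last by rewrite -natrD pnatr_eq0 addnS.
by apply: eq_bigr => j _; apply: eq_bigr => i _; rewrite /node -natrD addnA.
Qed.

Lemma fact_add_prod a k : (a + k)`!%:R = a`!%:R * \prod_(l < k) (a%:R + l.+1%:R) :> F.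
Proof.
elim: k => [|k IH]; first by rewrite addn0 big_ord0 mulr1.
by rewrite addnS factS natrM IH big_ord_recr /= -natrD addnS mulrC mulrA.
Qed.

(** At a natural number the linear factors combine into factorials, the form
    in which the function comes out of the integral. *)
Lemma well_poisedE d n m :
  well_poised d n m%:R =
  (m.*2 + (n * 3 + 2))%:R * (m + (n * 3).+1)`!%:R / m`!%:R *
  ((n + m)`!%:R / (n + m + n).+1`!%:R) ^+ d.+2.
Proof.
have f0 k : k`!%:R != 0 :> F by rewrite pnatr_eq0 -lt0n fact_gt0.
rewrite /well_poised /well_poised_numerator !hornerM !horner_prod.
rewrite !(hornerD, hornerZ, hornerX, hornerC).
have -> : 2 * m%:R + (n * 3 + 2)%:R = (m.*2 + (n * 3 + 2))%:R :> F.
  by rewrite -natrM -natrD mul2n.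
have E1 : \prod_(l < n) ('X + (l.+1)%:R%:P).[m%:R] = (m + n)`!%:R / m`!%:R :> F.
  rewrite fact_add_prod mulrAC mulfV // mul1r.
  by apply: eq_bigr => l _; rewrite !horner_XDC.
have E2 : \prod_(i < n.+1) (m%:R + node i) = (n + m + n).+1`!%:R / (n + m)`!%:R :> F.
  rewrite -addnS fact_add_prod mulrAC mulfV // mul1r; apply: eq_bigr => l _.
  by rewrite /node -!natrD; congr _%:R; lia.
have E3 : \prod_(l < n) ('X + (n.*2.+2 + l)%:R%:P).[m%:R] =
    (m + (n * 3).+1)`!%:R / (n + m + n).+1`!%:R :> F.
  have -> : (m + (n * 3).+1 = (n + m + n).+1 + n)%N by lia.
  rewrite fact_add_prod mulrAC mulfV // mul1r; apply: eq_bigr => l _.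
  by rewrite !horner_XDC -!natrD; congr _%:R; lia.
rewrite E1 E2 E3 [(m + n)%N]addnC.
rewrite -[X in X ^+ d.+1]invf_div exprVn invrK [in RHS]exprS.
by field; rewrite !f0.
Qed.

End WellPoised.

(** * Summing the well-poised rational function *)

Section ZetaSeries.
Variable R : realType.

Definition power_sum (F : fieldType) (j N : nat) : F :=
  \sum_(0 <= m < N) (m.+1%:R ^+ j)^-1.

Lemma cvg_sum_seq (I : eqType) (s : seq I) (u : I -> nat -> R) (l : I -> R) :
  (forall i, i \in s -> u i @ \oo --> l i) ->
  (fun N => \sum_(i <- s) u i N) @ \oo --> \sum_(i <- s) l i.
Proof.
elim: s => [|i s IH] ul.
  by rewrite big_nil; under eq_fun do rewrite big_nil; exact: cvg_cst.
rewrite big_cons; under eq_fun do rewrite big_cons.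
apply: cvgD; first by apply: ul; rewrite mem_head.
by apply: IH => j js; apply: ul; rewrite in_cons js orbT.
Qed.

(** The partial sums are bounded by [2 - 1/N], by comparison with
    [1/(N(N+1))]. *)
Lemma cvg_power_sum j : (1 < j)%N ->
  (power_sum R j : nat -> R) @ \oo --> riemann_zeta (j%:R : R).
Proof.
move=> j1.
have E : (power_sum R j : nat -> R) = series (fun m : nat => m.+1%:R `^ (- j%:R)).
  apply/funext => N; rewrite /power_sum /series /=; apply: eq_bigr => m _.
  by rewrite powR_invn.
rewrite /riemann_zeta -E; apply: nondecreasing_is_cvgn.
  apply/nondecreasing_seqP => N; rewrite /power_sum big_nat_recr //= lerDl.
  by rewrite invr_ge0 exprn_ge0.
exists 2 => _ [N _ <-].
suff H : power_sum R j N.+1 <= 2 - N.+1%:R^-1.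
  apply: (@le_trans _ _ (power_sum R j N.+1)).
    by rewrite [leRHS]/power_sum big_nat_recr //= lerDl invr_ge0 exprn_ge0.
  by rewrite (le_trans H) // gerBl invr_ge0.
elim: N => [|N IH].
  by rewrite /power_sum big_nat1 expr1n invr1; lra.
rewrite /power_sum big_nat_recr //=; apply: le_trans (lerD IH (lexx _)) _.
have : (N.+2%:R ^+ j)^-1 <= (N.+1%:R * N.+2%:R)^-1 :> R.
  rewrite lef_pV2 ?posrE ?exprn_gt0 ?mulr_gt0 ?ltr0n //.
  apply: (@le_trans _ _ (N.+2%:R ^+ 2)).
    by rewrite expr2 ler_pM2r ?ltr0n // ler_nat.
  by rewrite ler_weXn2l // ler1n.
have -> : (N.+1%:R * N.+2%:R)^-1 = N.+1%:R^-1 - N.+2%:R^-1 :> R.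
  rewrite -[N.+2%:R]natr1 -[N.+1%:R]natr1; field.
  by rewrite natr1 pnatr_eq0 natr1 pnatr_eq0.
by move: (_ ^- j) (N.+1%:R^-1) (N.+2%:R^-1) => x y z; lra.
Qed.

(** A difference of [p] terms that tend to zero; it holds for [j = 1] too,
    where the power sums diverge. *)
Lemma cvg_power_sum_shift j p : (0 < j)%N ->
  (fun N => power_sum R j (N + p) - power_sum R j N) @ \oo --> (0 : R).
Proof.
move=> j0; elim: p => [|p IH].
  by under eq_fun do rewrite addn0 subrr; exact: cvg_cst.
have -> : (fun N => power_sum R j (N + p.+1) - power_sum R j N) =
   (fun N => (power_sum R j (N + p) - power_sum R j N) + ((N + p).+1%:R ^+ j)^-1).
  apply/funext => N; rewrite addnS {1}/power_sum big_nat_recr //=.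
  rewrite -/(power_sum R j (N + p)).
  by rewrite addrAC.
rewrite -[X in _ --> X]addr0; apply: cvgD => //.
apply: (@squeeze_cvgr _ _ _ _ (cst 0) (@harmonic R)).
- near=> N; rewrite invr_ge0 exprn_ge0 //=.
  rewrite lef_pV2 ?posrE ?exprn_gt0 ?ltr0n //.
  apply: (@le_trans _ _ ((N + p).+1%:R ^+ 1)); first by rewrite ler_nat ltnS leq_addr.
  by rewrite ler_weXn2l // ler1n.
- exact: cvg_cst.
- exact: cvg_harmonic.
Unshelve. all: by end_near. Qed.

Lemma sum_shifted_powers (F : fieldType) j p N :
  \sum_(0 <= t < N) ((t + p.+1)%:R ^+ j)^-1 = power_sum F j (N + p) - power_sum F j p.
Proof.
rewrite /power_sum addnC (big_cat_nat (n := p) (p := p + N)) ?leq_addr //=.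
rewrite addrAC subrr add0r -{2}[p]add0n big_addn addKn.
by apply: eq_bigr => t _; rewrite addnS.
Qed.

(** Summed over [t], the terms of the node [p i + 1] give a difference of power
    sums, in which the shift by [p i] disappears in the limit.  For [j = 1] and
    for even [j] the lemma is used with coefficients of sum zero and [l = 0]. *)
Lemma cvg_sum_poles K (a : 'I_K -> R) (p : 'I_K -> nat) j (l : R) : (0 < j)%N ->
  (fun N => (\sum_i a i) * power_sum R j N) @ \oo --> l ->
  (fun N => \sum_(0 <= t < N) \sum_i a i / (t + (p i).+1)%:R ^+ j) @ \oo -->
    l - \sum_i a i * power_sum R j (p i).
Proof.
move=> j0 al.
have -> : (fun N => \sum_(0 <= t < N) \sum_i a i / (t + (p i).+1)%:R ^+ j) =
  (fun N => ((\sum_i a i) * power_sum R j N +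
     \sum_i a i * (power_sum R j (N + p i) - power_sum R j N)) -
     \sum_i a i * power_sum R j (p i)).
  apply/funext => N; rewrite exchange_big /= mulr_suml -big_split -sumrB /=.
  apply: eq_bigr => i _.
  rewrite -mulr_sumr sum_shifted_powers; ring.
apply: cvgB; last exact: cvg_cst.
rewrite -[l]addr0; apply: cvgD => //.
have E : \sum_i a i * 0 = 0 by rewrite big1 // => i _; rewrite mulr0.
rewrite -[X in _ --> X]E.
apply: (@cvg_sum_seq _ _
  (fun i N => a i * (power_sum R j (N + p i) - power_sum R j N))
  (fun i => a i * 0)) => i _.
by apply: cvgMl_tmp; exact: cvg_power_sum_shift.
Qed.

Lemma ratr_power_sum j N : ratr (power_sum rat j N) = power_sum R j N.
Proof.
rewrite /power_sum rmorph_sum; apply: eq_bigr => m _.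
by rewrite fmorphV rmorphXn /= ratr_nat.
Qed.

(** Orders [j] that are even or 1 contribute a rational number each, the odd
    orders from 3 to [d] contribute a rational multiple of [zeta(j)] as well;
    the top order [d + 1] is even. *)
Lemma well_poised_series d n : odd d -> (1 < d)%N ->
  exists2 r : R, odd_zeta_span R d r &
    (fun N => \sum_(0 <= t < N) well_poised d n (t%:R : R)) @ \oo --> r.
Proof.
move=> od d1.
have [a a0 af] := well_poised_partial_fractions rat n od d1.
pose p (i : 'I_n.+1) := (n + i)%N.
pose q j := \sum_i a j i.
pose z j : R := if odd j && (2 < j)%N then ratr (q j) * riemann_zeta j%:R else 0.
pose b j i : R := ratr (a j i).
pose l j := z j - \sum_i b j i * power_sum R j (p i).
have bq j : \sum_i b j i = ratr (q j) by rewrite rmorph_sum.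
have cv j : (0 < j)%N ->
  (fun N => \sum_(0 <= t < N) \sum_i b j i / (t + (p i).+1)%:R ^+ j) @ \oo --> l j.
  move=> j0; apply: cvg_sum_poles => //; rewrite bq /z.
  case: ifPn => [/andP[oj j2]|].
    by apply: cvgMl_tmp; apply: cvg_power_sum; exact: ltnW.
  rewrite negb_and -leqNgt => jP.
  have -> : q j = 0.
    apply: a0; case/orP: jP => [->|]; first by rewrite orbT.
    by move: j0; case: j => [|[|[]]].
  by under eq_fun do rewrite rmorph0 mul0r; exact: cvg_cst.
exists (\sum_(1 <= j < d.+2) l j).
  exists (- \sum_(1 <= j < d.+2) \sum_i a j i * power_sum rat j (p i)), q.
  rewrite sumrB addrC rmorphN /= rmorph_sum; congr (- _ + _).
    apply: eq_bigr => j _; rewrite rmorph_sum; apply: eq_bigr => i _.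
    by rewrite rmorphM /= ratr_power_sum.
  have z0 j : ~~ (odd j && (2 < j)%N) -> z j = 0 by rewrite /z => /negPf ->.
  have -> : \sum_(1 <= j < d.+2) z j = \sum_(1 <= j < d.+1) z j.
    by rewrite big_nat_recr //= z0 ?addr0 //= od.
  rewrite big_ltn ?ltnS ?(ltnW d1) // big_ltn ?ltnS //.
  rewrite !z0 // !add0r.
  by rewrite [RHS]big_mkcond; apply: eq_big_nat => j /andP[j3 _]; rewrite /z j3 andbT.
have -> : (fun N => \sum_(0 <= t < N) well_poised d n (t%:R : R)) =
  (fun N => \sum_(1 <= j < d.+2) \sum_(0 <= t < N) \sum_i b j i / (t + (p i).+1)%:R ^+ j).
  apply/funext => N; rewrite exchange_big /=; apply: eq_bigr => t _.
  have -> : well_poised d n (t%:R : R) = ratr (well_poised d n t%:R).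
    rewrite !well_poisedE; move: d.+2 => k.
    by rewrite !(rmorphM, rmorphXn, fmorphV) /= !ratr_nat.
  rewrite af rmorph_sum; apply: eq_bigr => j _.
  rewrite rmorph_sum; apply: eq_bigr => i _.
  by rewrite rmorphM fmorphV rmorphXn /= ratr_nat -addnA addSn.
apply: (@cvg_sum_seq _ _
  (fun j N => \sum_(0 <= t < N) \sum_i b j i / (t + (p i).+1)%:R ^+ j) l) => j.
by rewrite mem_index_iota => /andP[j0 _]; exact: cv.
Qed.

End ZetaSeries.

(** * Reduction to one variable *)

Section Peeling.
Variable R : realType.
Local Notation mu := (@lebesgue_measure R).
Local Notation XMonemX := (@XMonemX R).
Implicit Types (d n : nat) (q t : R) (f : R -> \bar R).

(** The operator [T] described above, on extended real functions. *)
Definition transform n f q : \bar R :=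
  (\int[mu]_(t in `[0%R, 1%R]) ((XMonemX n n t)%:E * f (1 - q * t)%R))%E.

(** [Q d] with the initial value 1 replaced by [q].  Then removing the first
    variable only changes [q], in agreement with the order in which the tuple
    measure is built, whereas [Q] itself unfolds from the last variable. *)
Fixpoint Q_from d q (x : seq R) : R :=
  if d is d'.+1 then 1 - Q_from d' q x * x`_d' else q.

Lemma Q_from_1 d x : Q_from d 1 x = Q d x.
Proof. by elim: d => //= d ->. Qed.

Lemma Q_from_cons d q t x : Q_from d.+1 q (t :: x) = Q_from d (1 - q * t) x.
Proof.
elim: d => // d IH.
by rewrite [LHS]/= -[X in X * _]/(Q_from d.+1 q (t :: x)) IH.
Qed.

(** Cutting the weight off outside [0, 1] turns all integrals into integrals
    over the whole space, to which Tonelli's theorem applies as it stands. *)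
Definition weight n t : R := (XMonemX n n \_ `[0, 1]) t.

Lemma weight_ge0 n t : 0 <= weight n t.
Proof.
by rewrite /weight patchE; case: ifPn => // ; rewrite inE /= => /XMonemX_ge0.
Qed.

Lemma measurable_weight n : measurable_fun setT (weight n).
Proof.
apply/(measurable_restrictT _ _).1 => //; exact: measurable_XMonemX.
Qed.

Local Notation tupleR d := (d.-tuple (measurableTypeR R)).

Definition integrand d n f q (x : tupleR d) : \bar R :=
  ((\prod_(j < d) weight n (tnth x j))%:E * f (Q_from d q x))%E.

Lemma measurable_entry d i : measurable_fun setT (fun x : tupleR d => (x : seq R)`_i).
Proof.
have [id|di] := ltnP i d.
  rewrite (_ : (fun _ => _) = (@tnth d _ ^~ (Ordinal id))).
    exact: measurable_tnth.
  by apply/funext => x; rewrite (tnth_nth 0).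
rewrite (_ : (fun _ => _) = cst 0) //.
by apply/funext => x; rewrite nth_default // size_tuple.
Qed.

Lemma measurable_Q_from d k q : measurable_fun setT (fun x : tupleR d => Q_from k q x).
Proof.
elim: k => [|k IH] /=; first exact: measurable_cst.
apply: measurable_funB; first exact: measurable_cst.
by apply: measurable_funM => //; exact: measurable_entry.
Qed.

Lemma measurable_integrand d n f q :
  measurable_fun setT f -> measurable_fun setT (@integrand d n f q).
Proof.
move=> mf; apply: emeasurable_funM.
  apply/measurable_EFinP; apply: measurable_prod => j _.
  by apply: measurableT_comp; [exact: measurable_weight|exact: measurable_tnth].
by apply: measurableT_comp => //; exact: measurable_Q_from.
Qed.

Lemma integrand_ge0 d n f q x :
  (forall r, 0 <= f r)%E -> (0 <= @integrand d n f q x)%E.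
Proof.
move=> f0; apply: mule_ge0 => //; rewrite lee_fin.
by apply: prodr_ge0 => j _; exact: weight_ge0.
Qed.

Lemma integrand_cons d n f q t (x : tupleR d) :
  integrand n f q (tuple_cons (t, x)) =
  ((weight n t)%:E * integrand n f (1 - q * t) x)%E.
Proof.
rewrite /integrand muleA -EFinM; congr (_%:E * _)%E; last by rewrite Q_from_cons.
rewrite big_ord_recl; congr (_ * _).
by apply: eq_bigr => j _; rewrite tnthS; congr (weight _ (tnth _ _)); exact/val_inj.
Qed.

(** Tonelli's theorem, one variable at a time. *)
Lemma integral_integrand d n f q :
  measurable_fun setT f -> (forall r, 0 <= f r)%E ->
  (\int[lebesgue_measure_tuple R d]_x integrand n f q x)%E = iter d (transform n) f q.
Proof.
move=> mf f0; elim: d q => [|d IH] q.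
  rewrite [LHS]integral_dirac //; last exact: measurable_integrand.
  by rewrite diracE mem_set // mul1e /integrand big_ord0 mul1e.
transitivity (\int[pushforward (mu \x lebesgue_measure_tuple R d)
    (@tuple_cons (measurableTypeR R) d)]_x (integrand n f q x))%E; first by [].
rewrite ge0_integral_pushforward //; first last.
- by move=> x _; exact: integrand_ge0.
- exact: measurable_integrand.
- exact: measurable_tuple_cons.
rewrite preimage_setT fubini_tonelli1; first last.
- by move=> x; exact: integrand_ge0.
- apply: measurableT_comp; first exact: measurable_integrand.
  exact: measurable_tuple_cons.
rewrite iterS /transform [in RHS]integral_mkcond; apply: eq_integral => t _.
rewrite /fubini_F /=.
under eq_integral do rewrite integrand_cons.
rewrite ge0_integralZl_EFin ?weight_ge0 //; first last.
- exact: measurable_integrand.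
- by move=> x _; exact: integrand_ge0.
rewrite IH /weight !patchE; case: ifPn => // _; exact: mul0e.
Qed.

(** [1/|r|^(n+1)]: nonnegative and measurable on the whole line, it agrees with
    [1/r^(n+1)] on [0, 1], and both are 0 at 0. *)
Definition inv_pow n (r : R) : \bar R := (`|r| `^ (- n.+1%:R))%:E.

Lemma measurable_inv_pow n : measurable_fun setT (inv_pow n).
Proof.
apply/measurable_EFinP.
apply: (@measurableT_comp _ _ _ _ _ _ (fun r : R => r `^ (- n.+1%:R))).
  exact: measurable_powR.
exact: normr_measurable.
Qed.

Lemma J_iter_transform d n : J R d n = iter d (transform n) (inv_pow n) 1.
Proof.
rewrite -integral_integrand; first last.
- by move=> r; rewrite lee_fin powR_ge0.
- exact: measurable_inv_pow.
rewrite /J integral_mkcond; apply: eq_integral => x _.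
rewrite patchE /integrand /inv_pow; case: ifPn => [|xN].
  rewrite inE /unit_cube /= => x01.
  rewrite -EFinM; congr (_%:E); congr (_ * _).
    by apply: eq_bigr => j _; rewrite /weight patchE mem_set //; exact: x01.
  have xi i : (i < d)%N -> 0 <= (x : seq R)`_i <= 1.
    by move=> id; have := x01 (Ordinal id); rewrite (tnth_nth 0) in_itv.
  have Q01 k : (k <= d)%N -> 0 <= Q k (x : seq R) <= 1.
    elim: k => [|k IH] kd /=; first by rewrite ler01 lexx.
    have /andP[Q0 Q1] := IH (ltnW kd); have /andP[y0 y1] := xi _ kd.
    by rewrite subr_ge0 mulr_ile1 //= gerBl mulr_ge0.
  have /andP[Q0 _] := Q01 _ (leqnn d).
  by rewrite Q_from_1 ger0_norm // powR_invn.
have [j jN] : exists j, ~~ (tnth x j \in `[0, 1]).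
  apply/existsP; rewrite -negb_forall; apply: contra xN => /forallP xA.
  by rewrite inE => j; exact: xA.
rewrite (bigD1 j) //= {1}/weight patchE memNset ?mul0r ?mul0e //.
by move=> /= h; rewrite h in jN.
Qed.

End Peeling.

(** * Expansion of the iterated integral *)

Section Assembly.
Variable R : realType.
Local Notation mu := (@lebesgue_measure R).
Local Notation XMonemX := (@XMonemX R).

Lemma integral_XMonemX a b :
  (\int[mu]_(t in `[0%R, 1%R]) (XMonemX a b t)%:E)%E =
  (a`!%:R * b`!%:R / (a + b).+1`!%:R)%:E.
Proof.
by rewrite integral_mkcond restrict_EFin -(EFin_beta_fun a.+1 b.+1) beta_fun_fact natrM.
Qed.

Lemma XMonemXE a b (t : R) : XMonemX a b t = t ^+ a * (1 - t) ^+ b.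
Proof. by []. Qed.

(** On polynomials the integral operator acts through the Beta moments. *)
Lemma transform_horner n (p : {poly R}) q :
  (\int[mu]_(t in `[0%R, 1%R]) (XMonemX n n t * p.[1 - q * t])%:E)%E =
  ((poly_transform n p).[q])%:E.
Proof.
pose r := p \Po (1 - 'X).
have pr t : p.[1 - q * t] = r.[q * t].
  by rewrite /r horner_comp !hornerE.
pose c j : R := r`_j * q ^+ j.
have E t : (XMonemX n n t * p.[1 - q * t])%:E =
    (\sum_(j < size r) (c j)%:E * (XMonemX (n + j) n t)%:E)%E.
  rewrite pr horner_coef mulr_sumr -sumEFin; apply: eq_bigr => j _.
  rewrite -EFinM; congr (_%:E); rewrite /c /XMonemX exprMn exprD; ring.
under eq_integral do rewrite E.
rewrite integral_sum //; last first.
  by move=> j; apply: integrableZl => //; exact: integrable_XMonemX.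
rewrite /poly_transform -/r horner_poly -sumEFin; apply: eq_bigr => j _.
rewrite integralZl //; last exact: integrable_XMonemX.
rewrite integral_XMonemX -EFinM; congr (_%:E).
rewrite /c /beta_moment; ring.
Qed.

(** [T] is a positive operator and [1 - q t] stays in [0, 1]. *)
Lemma iter_poly_transform_ge0 n d k (q : R) : 0 <= q <= 1 ->
  0 <= (iter d (poly_transform n) ((1 - 'X) ^+ k)).[q].
Proof.
elim: d q => [|d IH] q q01.
  by rewrite /= !hornerE exprn_ge0 // subr_ge0; case/andP: q01.
rewrite iterS -lee_fin -transform_horner; apply: integral_ge0 => t /= t01.
rewrite lee_fin mulr_ge0 ?XMonemX_ge0 //; apply: IH.
move: q01 t01; rewrite in_itv /= => /andP[q0 q1] /andP[t0 t1].
by rewrite subr_ge0 mulr_ile1 //= gerBl mulr_ge0.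
Qed.

(** By Pascal's rule the partial sums satisfy [s_(N+1) = x s_N + u_(N+1)] with
    [u] the partial sums for the previous exponent.  As [s] is nondecreasing
    this bounds [s_N], and then determines its limit. *)
Lemma cvg_binomial_series a (x : R) : 0 <= x < 1 ->
  (fun N => \sum_(0 <= l < N) 'C(a + l, l)%:R * x ^+ l) @ \oo --> ((1 - x) ^+ a.+1)^-1.
Proof.
move=> /andP[x0 x1]; elim: a => [|a IH].
  have := @cvg_geometric_series R 1 x; rewrite ger0_norm // => /(_ x1).
  rewrite mul1r expr1 => H; apply: cvg_trans H.
  apply: near_eq_cvg; near=> N; rewrite /series /=; apply: eq_bigr => l _.
  by rewrite add0n binn.
pose s N : R := \sum_(0 <= l < N) 'C(a.+1 + l, l)%:R * x ^+ l.
pose u N : R := \sum_(0 <= l < N) 'C(a + l, l)%:R * x ^+ l.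
have sE N : s N.+1 = x * s N + u N.+1.
  rewrite /s /u big_nat_recl // [in RHS]big_nat_recl // !addn0 !bin0 [RHS]addrCA.
  congr (_ + _); rewrite mulr_sumr -big_split; apply: eq_bigr => l _ /=.
  by rewrite addnS binS addSnnS -addSnnS natrD exprS; ring.
have uL N : u N <= ((1 - x) ^+ a.+1)^-1.
  rewrite -(cvg_lim _ IH) //; apply: nondecreasing_cvgn_le; last exact: cvgP IH.
  apply/nondecreasing_seqP => M; rewrite /u big_nat_recr //= lerDl.
  by rewrite mulr_ge0 ?exprn_ge0.
have s_nd N : s N <= s N.+1.
  by rewrite /s big_nat_recr //= lerDl mulr_ge0 ?exprn_ge0.
have x1' : 0 < 1 - x by rewrite subr_gt0.
have sc : cvgn s.
  apply: nondecreasing_is_cvgn; first exact/nondecreasing_seqP.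
  exists (((1 - x) ^+ a.+1)^-1 / (1 - x)) => _ [N _ <-].
  rewrite ler_pdivlMr // mulrBr mulr1 lerBlDr.
  by apply: le_trans (s_nd N) _; rewrite sE addrC [s N * x]mulrC lerD2r uL.
have E : limn s = x * limn s + ((1 - x) ^+ a.+1)^-1.
  have c1 : (fun N => s N.+1) @ \oo --> limn s by rewrite (cvg_shiftS s).
  have c2 : (fun N => s N.+1) @ \oo --> x * limn s + ((1 - x) ^+ a.+1)^-1.
    rewrite (_ : (fun N => s N.+1) = (fun N => x * s N + u N.+1)); last exact/funext.
    by apply: cvgD; [exact: cvgMl_tmp|rewrite (cvg_shiftS u)].
  exact: (cvg_unique _ c1 c2).
suff -> : ((1 - x) ^+ a.+2)^-1 = limn s by [].
apply: (mulIf (lt0r_neq0 x1')); rewrite [RHS]mulrBr mulr1 [limn s * x]mulrC {1}E.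
rewrite [x * _ + _]addrC addrK exprSr invfM -mulrA mulVf ?mulr1 //.
exact: lt0r_neq0.
Unshelve. all: by end_near. Qed.

Lemma nneseries_EFin (u : nat -> R) l :
  (fun N => \sum_(0 <= k < N) u k) @ \oo --> l ->
  (\sum_(k <oo) (u k)%:E)%E = l%:E.
Proof.
move=> ul; apply/cvg_lim => //.
under eq_fun do rewrite sumEFin.
by apply: cvg_EFin; first exact: nearW.
Qed.

Lemma nneseries_inv_pow n (x : R) : 0 <= x < 1 ->
  (\sum_(k <oo) ('C(n + k, k)%:R * x ^+ k)%:E)%E = inv_pow n (1 - x).
Proof.
move=> x01; rewrite (nneseries_EFin (@cvg_binomial_series n x x01)) /inv_pow.
have /andP[_ x1] := x01.
by rewrite ger0_norm ?powR_invn // subr_ge0 ltW.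
Qed.

Lemma unit_sub_mul (q t : R) : 0 <= q <= 1 -> 0 <= t <= 1 -> 0 <= 1 - q * t <= 1.
Proof.
move=> /andP[q0 q1] /andP[t0 t1].
by rewrite subr_ge0 mulr_ile1 //= gerBl mulr_ge0.
Qed.

(** Termwise integration by monotone convergence.  Including the right end
    point or not makes no difference. *)
Lemma integral_poly_series n (c : nat -> R) (p : nat -> {poly R}) q b :
  0 <= q <= 1 -> (forall k, 0 <= c k) ->
  (forall k r, 0 <= r <= 1 -> 0 <= (p k).[r]) ->
  (\int[mu]_(t in [set` Interval (BLeft 0%R) (BSide b 1%R)])
     ((XMonemX n n t)%:E * \sum_(k <oo) (c k * (p k).[1 - q * t])%:E))%E =
  (\sum_(k <oo) (c k * (poly_transform n (p k)).[q])%:E)%E.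
Proof.
move=> q01 c0 p0; set D := [set` _].
have D01 t : D t -> 0 <= t <= 1.
  rewrite /D /= in_itv /=; case: b {D} => /andP[-> h] //=; exact: ltW.
have w0 t : D t -> 0 <= XMonemX n n t.
  by move=> Dt; apply: XMonemX_ge0; rewrite in_itv; exact: D01.
have cp0 k t : D t -> 0 <= c k * (p k).[1 - q * t].
  by move=> Dt; rewrite mulr_ge0 // p0 // unit_sub_mul // D01.
have mh k : measurable_fun setT (fun t : R => XMonemX n n t * (p k).[1 - q * t]).
  apply: measurable_funM; first exact: measurable_XMonemX.
  apply: continuous_measurable_fun => t.
  apply: (@continuous_comp _ _ _ (fun t : R => 1 - q * t) (horner (p k))).
    by apply: cvgB; [exact: cvg_cst|exact: cvgMl_tmp].
  exact: continuous_horner.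
pose h k t := ((c k)%:E * (XMonemX n n t * (p k).[1 - q * t])%:E)%E.
transitivity (\int[mu]_(t in D) \sum_(k <oo) h k t)%E.
  apply: eq_integral => t; rewrite inE => Dt.
  rewrite -nneseriesZl => [|k _]; last by rewrite lee_fin cp0.
  by apply: eq_eseriesr => k _; rewrite /h -!EFinM; congr (_%:E); ring.
have mD : measurable (D : set R) by exact: measurable_itv.
rewrite integral_nneseries //; first last.
- move=> k t Dt; rewrite /h -EFinM lee_fin mulrCA mulr_ge0 ?w0 //.
  exact: cp0.
- move=> k; apply/measurable_EFinP; apply: measurable_funM => //.
  by apply: measurable_funTS; exact: mh.
apply: eq_eseriesr => k _; rewrite /h.
rewrite ge0_integralZl_EFin //; first last.
- by apply/measurable_EFinP; apply: measurable_funTS; exact: mh.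
- move=> t Dt; rewrite lee_fin mulr_ge0 ?w0 // p0 // unit_sub_mul //; exact: D01.
rewrite EFinM -transform_horner; congr (_ * _)%E.
rewrite /D; case: b {D D01 w0 cp0 mD} => //.
rewrite integral_itv_bndo_bndc //.
by apply/measurable_EFinP; apply: measurable_funTS; exact: mh.
Qed.

(** One application of [T] is needed for the expansion to hold at [q = 1]: at
    [q t = 1] the binomial series diverges while [inv_pow] vanishes. *)
Lemma iter_transform_series d n (q : R) : 0 <= q <= 1 ->
  iter d.+1 (transform n) (inv_pow n) q =
  (\sum_(k <oo) ('C(n + k, k)%:R *
     (iter d.+1 (poly_transform n) ((1 - 'X) ^+ k)).[q])%:E)%E.
Proof.
elim: d q => [|d IH] q q01.
  rewrite /= -(@integral_poly_series n (fun k => 'C(n + k, k)%:R)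
    (fun k => (1 - 'X) ^+ k) q true) //.
    (* off t = 1 the argument q t of the binomial series is less than 1 *)
    rewrite /transform -integral_itv_bndo_bndc; last first.
      apply: measurable_funTS; apply: emeasurable_funM.
        by apply/measurable_EFinP; exact: measurable_XMonemX.
      apply: measurableT_comp; first exact: measurable_inv_pow.
      by apply: measurable_funB => //; exact: measurable_funM.
    apply: eq_integral => t; rewrite inE /= in_itv /= => /andP[t0 t1].
    congr (_ * _)%E; rewrite -nneseries_inv_pow.
      by apply: eq_eseriesr => k _; rewrite !hornerE subKr.
    case/andP: q01 => q0 q1; rewrite mulr_ge0 //=.
    by apply: le_lt_trans t1; exact: ler_piMl.
  by move=> k r /andP[r0 r1]; rewrite !hornerE exprn_ge0 // subr_ge0.
rewrite iterS; apply: esym.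
under eq_eseriesr => k _ do rewrite iterS.
rewrite -(@integral_poly_series n (fun k => 'C(n + k, k)%:R)
  (fun k => iter d.+1 (poly_transform n) ((1 - 'X) ^+ k)) q false) //; last first.
  by move=> k r; exact: iter_poly_transform_ge0.
apply: esym; apply: eq_integral => t; rewrite inE => t01.
congr (_ * _)%E; apply: IH; apply: unit_sub_mul => //.
Qed.


(** The value at 1 of a hypergeometric series [2F1]: its terms are Beta
    integrals, and under the integral sign the sum becomes a binomial series
    again, with exponent [n + m]. *)
Lemma gauss_sum n m :
  (\sum_(k <oo) ('C(n + k, k)%:R * 'C(k, m)%:R *
      ((n + k)`!%:R / (m + k + (n * 3 + 2))`!%:R))%:E)%E =
  ((n + m)`!%:R ^+ 2 / (m`!%:R * (n + m + n).+1`!%:R ^+ 2))%:E :> \bar R.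
Proof.
pose c := (n + m + n).+1.
have f0 k : k`!%:R != 0 :> R by exact: factr_neq0.
pose h k t := ('C(n + k, k)%:R * 'C(k, m)%:R / c`!%:R * XMonemX (n + k) c t)%:E.
transitivity (\sum_(k <oo) \int[mu]_(t in `[0%R, 1%R[) h k t)%E.
  apply: eq_eseriesr => k _; rewrite /h.
  under eq_integral do rewrite EFinM.
  rewrite ge0_integralZl_EFin //; first last.
  - by apply/measurable_EFinP; exact: measurable_XMonemX.
  - move=> t /=; rewrite in_itv /= => /andP[t0 t1]; rewrite lee_fin XMonemX_ge0 //.
    by rewrite in_itv /= t0 ltW.
  rewrite integral_itv_bndo_bndc; last first.
    by apply/measurable_EFinP; exact: measurable_XMonemX.
  rewrite integral_XMonemX -EFinM; congr (_%:E).
  have -> : (m + k + (n * 3 + 2) = (n + k + c).+1)%N by rewrite /c; lia.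
  by field; rewrite !f0.
rewrite -integral_nneseries //; first last.
- move=> k t /=; rewrite in_itv /= => /andP[t0 t1]; rewrite lee_fin mulr_ge0 //.
  by rewrite XMonemX_ge0 // in_itv /= t0 ltW.
- move=> k; apply/measurable_EFinP; apply: measurable_funM => //.
  exact: measurable_XMonemX.
transitivity (\int[mu]_(t in `[0%R, 1%R[)
   (('C(n + m, m)%:R / c`!%:R)%:E * (XMonemX (n + m) n t)%:E))%E.
  apply: eq_integral => t; rewrite inE /= in_itv => /andP[t0 t1].
  have t01 : 0 <= t < 1 by rewrite (t0 : 0 <= t).
  rewrite -EFinM; apply: nneseries_EFin; rewrite -(cvg_shiftn m).
  have H := @cvg_binomial_series (n + m) t t01.
  pose K : R := 'C(n + m, m)%:R / c`!%:R * (t ^+ (n + m) * (1 - t) ^+ c).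
  have -> : 'C(n + m, m)%:R / c`!%:R * XMonemX (n + m) n t =
            K * ((1 - t) ^+ (n + m).+1)^-1.
    rewrite /K !XMonemXE /c -(addSn (n + m) n) [(1 - t) ^+ (_.+1 + _)]exprD.
    have u0 : (1 - t) ^+ (n + m).+1 != 0 by rewrite expf_neq0 // subr_eq0 gt_eqF.
    by move: ((1 - t) ^+ _.+1) u0 => u u0; field; rewrite f0 u0.
  have -> : (fun N => \sum_(0 <= k < N + m) ('C(n + k, k)%:R * 'C(k, m)%:R / c`!%:R *
        XMonemX (n + k) c t)) =
     (fun N => K * \sum_(0 <= l < N) 'C(n + m + l, l)%:R * t ^+ l).
    apply/funext => N; rewrite addnC (big_cat_nat (n := m) (p := m + N)) ?leq_addr //=.
    rewrite big_nat_cond big1 ?add0r => [|k /andP[/andP[_ km] _]]; last first.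
      by rewrite (bin_small km) mulr0 !mul0r.
    rewrite -{1}[m]add0n big_addn addKn mulr_sumr; apply: eq_bigr => l _.
    have -> : 'C(n + (l + m), l + m)%:R * 'C(l + m, m)%:R =
              'C(n + m, m)%:R * 'C(n + m + l, l)%:R :> R.
      have -> : (n + (l + m) = (l + m) + n)%N by rewrite addnC.
      have -> : 'C(l + m, m)%:R = (l + m)`!%:R / (m`!%:R * l`!%:R) :> R.
        by rewrite addnC binrE.
      have -> : 'C(n + m, m)%:R = (n + m)`!%:R / (m`!%:R * n`!%:R) :> R.
        by rewrite addnC binrE.
      have -> : 'C(n + m + l, l)%:R = (n + m + l)`!%:R / (l`!%:R * (n + m)`!%:R) :> R.
        by rewrite addnC binrE.
      rewrite binrE; have -> : (l + m + n = n + m + l)%N by lia.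
      by field; rewrite !f0.
    rewrite /K XMonemXE [(l + m)%N]addnC addnA [t ^+ (_ + l)]exprD; ring.
  exact: cvgMl_tmp.
rewrite ge0_integralZl_EFin //; first last.
- by apply/measurable_EFinP; exact: measurable_XMonemX.
- move=> t /=; rewrite in_itv /= => /andP[t0 t1]; rewrite lee_fin XMonemX_ge0 //.
  by rewrite in_itv /= t0 ltW.
rewrite integral_itv_bndo_bndc; last first.
  by apply/measurable_EFinP; exact: measurable_XMonemX.
rewrite integral_XMonemX -EFinM; congr (_%:E).
rewrite [X in 'C(X, m)]addnC binrE [(m + n)%N]addnC -/c.
by field; rewrite !f0.
Qed.


Lemma nneseries_finite (u : nat -> R) N : (forall m, (N <= m)%N -> u m = 0) ->
  (\sum_(m <oo) (u m)%:E)%E = (\sum_(m < N) u m)%:E.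
Proof.
move=> u0; apply: nneseries_EFin; apply: cvg_near_cst; exists N => // M /= NM.
rewrite (big_cat_nat (n := N)) //= big_mkord [X in _ + X]big_nat_cond.
by rewrite [X in _ + X]big1 ?addr0 // => m /andP[/andP[Nm _] _]; exact: u0.
Qed.

Lemma odd_zeta_spanZ d (c : rat) (r : R) :
  odd_zeta_span R d r -> odd_zeta_span R d (ratr c * r).
Proof.
move=> [q0 [q ->]]; exists (c * q0), (fun k => c * q k).
rewrite mulrDr mulr_sumr rmorphM; congr (_ + _).
by apply: eq_bigr => k _; rewrite rmorphM mulrA.
Qed.

(** For odd [d], [m + m d] is even. *)
Lemma sign_eigenvalue n m d : odd d ->
  (-1) ^+ m * eigenvalue R n m ^+ d = beta_moment R n m ^+ d.
Proof.
move=> od; rewrite /eigenvalue exprMn mulrA -exprM -exprD -signr_odd.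
by rewrite oddD oddM od andbT addbb mul1r.
Qed.

Lemma projection_eigenvalue_ge0 n k m d :
  odd d -> 0 <= projection R n k m * eigenvalue R n m ^+ d.
Proof.
move=> od; rewrite /projection.
rewrite mulrC -!mulrA mulrCA mulrA sign_eigenvalue //.
by rewrite !mulr_ge0 ?exprn_ge0 ?divr_ge0 ?mulr_ge0.
Qed.

(** All terms are nonnegative, so the sums over [k] and [m] can be
    exchanged. *)
Lemma J_well_poised d n : odd d ->
  (J R d n = \sum_(m <oo) (n`!%:R ^+ d.-1 * well_poised d n (m%:R : R))%:E)%E.
Proof.
case: d => // d od; rewrite J_iter_transform iter_transform_series ?lexx ?ler01 //.
pose a k m : R := 'C(n + k, k)%:R * (projection R n k m * eigenvalue R n m ^+ d.+1).
transitivity (\sum_(k <oo) \sum_(m <oo) (a k m)%:E)%E.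
  apply: eq_eseriesr => k _; rewrite (nneseries_finite (N := k.+1)).
    by rewrite iter_poly_transform1 mulr_sumr.
  by move=> m km; rewrite /a /projection (bin_small km) !(mulr0, mul0r).
rewrite nneseries_interchange; last first.
  by move=> k m; rewrite lee_fin mulr_ge0 // projection_eigenvalue_ge0.
apply: eq_eseriesr => m _.
(* the part of the summand that does not depend on k *)
pose K := beta_moment R n m ^+ d.+1 *
  ((m.*2 + (n * 3 + 2))%:R * (m + (n * 3).+1)`!%:R / n`!%:R).
transitivity (\sum_(k <oo) (K%:E * ('C(n + k, k)%:R * 'C(k, m)%:R *
      ((n + k)`!%:R / (m + k + (n * 3 + 2))`!%:R))%:E))%E.
  apply: eq_eseriesr => k _; rewrite -EFinM; congr (_%:E).
  rewrite /a /K -(sign_eigenvalue n m od) /projection.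
  move: (eigenvalue R n m ^+ d.+1) ((-1) ^+ m) => u v; ring.
rewrite nneseriesZl => [|k _]; last by rewrite lee_fin.
rewrite gauss_sum -EFinM; congr (_%:E).
have f0 k : k`!%:R != 0 :> R by exact: factr_neq0.
rewrite /K /beta_moment well_poisedE [d.+1.-1]/=.
set x := (n + m)`!%:R; set c := (n + m + n).+1`!%:R.
have -> : x * n`!%:R / c = x / c * n`!%:R :> R by rewrite mulrAC.
have -> : x ^+ 2 / (m`!%:R * c ^+ 2) = (x / c) ^+ 2 / m`!%:R :> R.
  by field; rewrite /c !f0.
move: (x / c) => y; rewrite exprMn ![_ ^+ d.+1]exprSr ![_ ^+ d.+3]exprSr.
by rewrite ![_ ^+ d.+2]exprSr ![_ ^+ d.+1]exprSr; field; rewrite !f0.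
Qed.

End Assembly.

Theorem mainTheorem2 (R : realType) (d n : nat) :
  odd d -> (3 <= d)%N ->
  exists2 r : R, odd_zeta_span R d r & J R d n = r%:E.
Proof.
move=> od d3.
have [r rspan wpr] := well_poised_series R n od (ltnW d3).
exists (ratr (n`!%:R ^+ d.-1) * r); first exact: odd_zeta_spanZ.
rewrite J_well_poised //; apply: nneseries_EFin.
under eq_fun do rewrite -mulr_sumr.
by rewrite rmorphXn /= ratr_nat; exact: cvgMl_tmp.
Qed.
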